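(* Let $r\in\mathbb{C}[z_1,z_2]$ be non-constant and essentially $\mathbb{T}^2$-symmetric, say $\tilde r=\lambda r$ with $\lambda\in\mathbb{T}$, with no zeros on $\mathbb{D}^2$. Then there is a rational inner function $\phi$ on $\mathbb{D}^2$ such that $\mathcal{L}_\lambda(\phi)=\mathcal{Z}_r$.
   Context: $\mathbb{D}$ is the open unit disk and $\mathbb{T}$ the unit circle. For a polynomial $r\in\mathbb{C}[z_1,z_2]$ of bidegree $(m,n)$, its reflection is $\tilde r(z_1,z_2)=z_1^mz_2^n\overline{r(1/\bar z_1,1/\bar z_2)}$; $r$ is essentially $\mathbb{T}^2$-symmetric if $\tilde r=\lambda r$ for some unimodular constant $\lambda$. $\mathcal{Z}_r=\{z\in\mathbb{C}^2:r(z)=0\}$. A rational inner function (RIF) on $\mathbb{D}^2$ is a rational function that is holomorphic and bounded on $\mathbb{D}^2$ with $|\phi|=1$ a.e. on $\mathbb{T}^2$. For an RIF written in lowest terms as $\phi=f/g$ with polynomials $f,g$ and for $\lambda\in\mathbb{T}$, $\mathcal{L}_\lambda(\phi)=\{z\in\mathbb{C}^2:f(z)=\lambda g(z)\}$. *)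

(* Defs.v *)
From HB Require Import structures.
From mathcomp Require Import all_boot all_order all_algebra.
From mathcomp Require Import polyXY fraction.
From mathcomp Require Import complex.
From mathcomp Require Import all_classical all_reals all_analysis.

Set Implicit Arguments.
Unset Strict Implicit.
Unset Printing Implicit Defensive.
Import Order.TTheory GRing.Theory Num.Theory.
Import numFieldNormedType.Exports.

Local Open Scope classical_set_scope.
Local Open Scope ring_scope.
Local Open Scope complex_scope.

(* A polynomial p in C[z1, z2] is an element of {poly {poly C}}, evaluated by
   the notation p.[z1, z2] of polyXY: z1 is the outer variable 'X and z2 the
   inner variable 'Y, so p`_i`_j is the coefficient of z1^i z2^j. *)
Section RationalInner.
Variable R : realType.
Local Notation C := R[i].
Local Notation poly2 := {poly {poly C}}.
Implicit Types (p f g : poly2) (phi : {fraction poly2}).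

Definition bidisk : set (C * C) := [set z | `|z.1| < 1 /\ `|z.2| < 1].

Definition zero_set p : set (C * C) := [set z | p.[z.1, z.2] = 0].

Definition bidegree p : nat * nat := ((size p).-1, (sizeY p).-1).

(* Coefficientwise form of z1^m z2^n conj (p (1 / conj z1, 1 / conj z2));
   see reflectionE. *)
Definition reflection p : poly2 :=
  let: (m, n) := bidegree p in
  \poly_(i < m.+1) \poly_(j < n.+1) conjc p`_(m - i)`_(n - j).

Lemma horner2_sum p (a b : nat) (x y : C) : (size p <= a)%N ->
  (sizeY p <= b)%N ->
  p.[x, y] = \sum_(i < a) \sum_(j < b) p`_i`_j * x ^+ i * y ^+ j.
Proof.
move=> pa pb; rewrite (horner_coef_wide _ pa) horner_sum.
apply: eq_bigr => i _; rewrite hornerM -polyC_exp hornerC.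
have pib : (size (p`_i)%R <= b)%N.
  by apply: leq_trans pb; exact: max_size_coefXY.
rewrite (horner_coef_wide _ pib) mulr_suml; apply: eq_bigr => j _.
by rewrite mulrAC.
Qed.

Lemma reflectionE p (x y : C) : x != 0 -> y != 0 ->
  (reflection p).[x, y] = x ^+ (bidegree p).1 * y ^+ (bidegree p).2
                          * conjc p.[(conjc x)^-1, (conjc y)^-1].
Proof.
move=> x0 y0; rewrite /reflection /bidegree /=.
set m := (size p).-1; set n := (sizeY p).-1.
rewrite (@horner2_sum p m.+1 n.+1) ?leqSpred//.
rewrite horner_poly horner_sum.
rewrite (reindex_inj rev_ord_inj) /= rmorph_sum mulr_sumr.
apply: eq_bigr => i _; rewrite hornerM -polyC_exp hornerC horner_poly.
rewrite (reindex_inj rev_ord_inj) /= rmorph_sum mulr_sumr mulr_suml.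
apply: eq_bigr => j _.
have im : (i <= m)%N by rewrite -ltnS.
have jn : (j <= n)%N by rewrite -ltnS.
rewrite !subSS !subKn// !rmorphM !rmorphXn !fmorphV /= !conjcK.
rewrite !exprB ?unitfE// !exprVn.
by rewrite [LHS](AC (1*2*2) ((4*2)*(1*5*3))).
Qed.

(* f / g is a quotient in lowest terms equal to phi; it is unique up to
   multiplying f and g by the same nonzero constant. *)
Definition lowest_terms phi f g : Prop :=
  [/\ g != 0, phi = tofrac f / tofrac g &
      forall d f' g', f = d * f' -> g = d * g' -> d \is a GRing.unit].

(* phi is regular at z with value w. *)
Definition ratfun_value phi (z : C * C) (w : C) : Prop :=
  exists f g, [/\ phi = tofrac f / tofrac g, g.[z.1, z.2] != 0 &
                  w = f.[z.1, z.2] / g.[z.1, z.2]].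

Lemma ratfun_value_uniq phi z w w' :
  ratfun_value phi z w -> ratfun_value phi z w' -> w = w'.
Proof.
have nz (g : poly2) : g.[z.1, z.2] != 0 -> tofrac g != 0.
  by rewrite tofrac_eq0; apply: contraNneq => ->; rewrite !horner0.
move=> [f [g [-> gz ->]]] [f' [g' [/eqP E g'z ->]]].
apply/eqP; move: E; rewrite !eqr_div ?nz// -!tofracM tofrac_eq => /eqP E.
by rewrite -!hornerM E.
Qed.

Definition unit_point (t : R) : C := cos t +i* sin t.

(* Differentiability is over C, so it is holomorphy on the open bidisk.  The
   torus carries the Lebesgue measure of the angles in [0, 2 pi[. *)
Definition rational_inner phi : Prop :=
  (exists h : C^o * C^o -> C^o,
    [/\ forall z, bidisk z -> ratfun_value phi z (h z),
        forall z : C^o * C^o, bidisk z -> differentiable h z &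
        exists M : R, forall z, bidisk z -> `|h z| <= M%:C]) /\
  {ae (@lebesgue_measure R \x @lebesgue_measure R)%E, forall t : R * R,
    0 <= t.1 < 2 * pi -> 0 <= t.2 < 2 * pi ->
    exists2 w, ratfun_value phi (unit_point t.1, unit_point t.2) w & `|w| = 1}.

Definition level_set (lam : C) phi : set (C * C) :=
  [set z | exists f g, lowest_terms phi f g /\
                       f.[z.1, z.2] = lam * g.[z.1, z.2]].

End RationalInner.

(* Main.v *)
(* Let (m, n) be the bidegree of r, N = m + n, and E = z1 d/dz1 + z2 d/dz2 the
   Euler operator.  The function is phi = - lam E r / (N r - E r): numerator
   minus lam times denominator is - lam N r.  On the torus the symmetry of r
   makes the two parts equal in modulus.  For z in the bidisk the one-variable
   polynomial q(t) = r(t z) has degree at most N and all its zeros a satisfy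
   |a| > 1, so Re (q'(1) / q(1)) = sum Re 1 / (1 - a) <= N / 2, which gives
   |E r(z)| <= |N r(z) - E r(z)| <> 0.  Cancelling the common factor d of
   numerator and denominator replaces r by a constant multiple of s = r / d.
   This loses no zero: d divides E r, so on the line through 0 and a zero z of d
   the polynomial d(t z) divides t q'(t), whose order of vanishing at t = 1 is
   one less than that of q(t) = d(t z) s(t z); hence s(z) = 0. *)
Require Import Defs.
From mathcomp Require Import all_boot all_order all_algebra.
From mathcomp Require Import polyXY fraction.
From mathcomp Require Import complex.
From mathcomp Require Import all_classical all_reals all_analysis.
From mathcomp Require Import measurable_realfun.
From mathcomp Require Import ring lra zify.
Import Order.TTheory GRing.Theory Num.Theory.
Import numFieldNormedType.Exports.
Local Open Scope classical_set_scope.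
Local Open Scope ring_scope.

Set Implicit Arguments.
Unset Strict Implicit.
Unset Printing Implicit Defensive.

(** * Zeros and derivatives of polynomials in one variable *)

(** If s(a) <> 0, then d s vanishes at a to the same order as d, and its derivative to one order
    less (characteristic zero). As a <> 0, the factor ['X] cannot make up for this. *)
Lemma root_cofactor_of_dvd_deriv (K : numFieldType) (d s e : {poly K}) (a : K) :
  a != 0 -> d != 0 -> root d a -> 'X * (d * s)^`() = d * e -> root s a.
Proof.
move=> a0 d0 da E; apply/negPn/negP => sa.
have [k [d1 +]] := multiplicity_XsubC d a; rewrite d0 /= => d1a dE.
case: k dE => [|k] dE; first by rewrite dE expr0 mulr1 (negPf d1a) in da.
(* The hypothesis divided by (X - a)^k, where d = d1 (X - a)^(k+1). At X = a only a (k+1) d1(a) s(a)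
   = 0 remains. *)
have H : 'X * ((d1 * s)^`() * ('X - a%:P) + (d1 * s) *+ k.+1)
         = d1 * ('X - a%:P) * e.
  have wn0 : ('X - a%:P) ^+ k != 0 by rewrite expf_neq0 ?polyXsubC_eq0.
  have dsE : d * s = (d1 * s) * ('X - a%:P) ^+ k.+1 by rewrite dE; ring.
  apply: (mulfI wn0); transitivity (d * e); last by rewrite dE exprS; ring.
  rewrite -E dsE [in RHS](derivM (d1 * s)) deriv_exp derivXsubC mul1r /= exprS.
  rewrite -(mulr_natr (_ ^+ k)) -(mulr_natr (d1 * s)).
  by move: (_ ^+ k) (_^`()) (k.+1%:R : {poly K}) => w u n; ring.
have /eqP := congr1 (horner^~ a) H.
rewrite !hornerE subrr !(mulr0, mul0r, add0r) hornerMn hornerM !mulf_eq0.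
rewrite mulrn_eq0 mulf_eq0 /= (negPf a0) /=.
by move: d1a sa; rewrite /root => /negPf -> /negPf ->.
Qed.

(* Each zero [a] contributes [(1 - a)^-1] to the logarithmic derivative at 1,
   and [1 - 2 Re (1 - a)^-1 = (|a|^2 - 1) / |1 - a|^2]. *)
Lemma logderiv_at1 (K : numClosedFieldType) (s : seq K) :
  {in s, forall a, 1 < `|a|} ->
  exists2 w, (\prod_(a <- s) ('X - a%:P))^`().[1] =
             w * (\prod_(a <- s) ('X - a%:P)).[1] & w + w^* <= (size s)%:R.
Proof.
elim: s => [|a s IH] hs.
  by exists 0; rewrite ?big_nil ?derivC ?hornerC ?mul0r // conjC0 addr0.
have hs' : {in s, forall b, 1 < `|b|}.
  by move=> b bs; apply: hs; rewrite inE bs orbT.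
have [w IHw wle] := IH hs'.
have a1 : 1 < `|a| by apply: hs; rewrite inE eqxx.
have na1 : 1 - a != 0.
  by rewrite subr_eq0; apply: contraTneq a1 => <-; rewrite normr1 ltxx.
exists (w + (1 - a)^-1).
  rewrite big_cons derivM derivXsubC hornerD !hornerM hornerC hornerXsubC IHw.
  by field.
rewrite /= rmorphD /= addrACA -natr1; apply: lerD => //.
rewrite -subr_ge0.
have na1' : (1 - a)^* != 0 by rewrite conjC_eq0.
have -> : 1 - ((1 - a)^-1 + ((1 - a)^-1)^*) =
   (`|a| ^+ 2 - 1) / ((1 - a) * (1 - a)^*).
  rewrite normCK fmorphV; move: na1'; rewrite rmorphB rmorph1 /= => na1'.
  by field; rewrite na1 na1'.
by rewrite -normCK divr_ge0 ?exprn_ge0 ?subr_ge0 ?exprn_ege1 ?normr_ge0 ?ltW.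
Qed.

(** Write q'(1) = w q(1) with 2 Re w <= N. Then w = N would give 2 N <= N, and |N - w|^2 - |w|^2 = N
    (N - 2 Re w) >= 0. *)
Lemma deriv_at1_bound (K : numClosedFieldType) (q : {poly K}) (N : nat) :
  (0 < N)%N -> (size q <= N.+1)%N -> (forall a, root q a -> 1 < `|a|) ->
  N%:R * q.[1] - q^`().[1] != 0 /\
  `|q^`().[1]| <= `|N%:R * q.[1] - q^`().[1]|.
Proof.
move=> N0 qN qa.
have q1 : q.[1] != 0.
  by apply/negP => /(qa 1); rewrite normr1 ltxx.
have q0 : q != 0 by apply: contraNneq q1 => ->; rewrite horner0.
have [s qE] := closed_field_poly_normal q.
have sN : (size s <= N)%N.
  by move: qN; rewrite qE size_scale ?lead_coef_eq0// size_prod_XsubC ltnS.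
have hs : {in s, forall a, 1 < `|a|}.
  move=> a sa; apply: qa.
  by rewrite qE rootZ ?lead_coef_eq0// root_prod_XsubC.
have [w Hw wle] := logderiv_at1 hs.
have q'E : q^`().[1] = w * q.[1].
  by rewrite qE derivZ !hornerZ Hw; ring.
have {}wle : w + w^* <= N%:R by apply: le_trans wle _; rewrite ler_nat.
rewrite q'E -mulrBl !normrM; split.
  rewrite mulf_neq0// subr_eq0; apply: contraTneq wle => <-.
  by rewrite conjC_nat gerDl lern0 -lt0n.
apply: ler_wpM2r => //; rewrite -ler_sqr ?nnegrE// !normCK.
rewrite -subr_ge0 rmorphB /= conjC_nat.
have -> : (N%:R - w) * (N%:R - w^*) - w * w^* = N%:R * (N%:R - (w + w^*)).
  by ring.
by rewrite mulr_ge0 ?subr_ge0.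
Qed.

(** * Lowest terms in K[z1, z2] *)

Section LowestTerms.
Variable K : closedFieldType.
Implicit Types (c : {poly K}) (d f g h : {poly {poly K}}).

Definition no_common_factor f g : Prop :=
  forall d f' g', f = d * f' -> g = d * g' -> d \is a GRing.unit.

(** The map [map_poly (horner_eval a)] substitutes z2 = a; if it kills f, then z2 - a divides every
    coefficient of f. *)
Lemma dvd_polyC_XsubC f (a : K) : map_poly (horner_eval a) f = 0 ->
  exists f', f = ('X - a%:P)%:P * f'.
Proof.
move=> fa; exists (\poly_(i < size f) (f`_i %/ ('X - a%:P))).
apply/polyP => i; rewrite coefCM coef_poly.
case: ltnP => [_|fi]; last by rewrite mulr0 nth_default.
rewrite mulrC divpK// dvdp_XsubCl /root.
by have := congr1 (coefp i) fa; rewrite /= coef_map coef0 /= => /eqP.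
Qed.

Lemma eval_polyC_XsubC (a : K) h :
  map_poly (horner_eval a) (('X - a%:P)%:P * h) = 0.
Proof.
by rewrite rmorphM /= map_polyC /= /horner_eval hornerXsubC subrr mul0r.
Qed.

(** The linear factors z2 - a of c are cancelled one at a time: each is prime and divides f0 h and
    g0 h, but not both f0 and g0, so it divides h. *)
Lemma cancel_polyC c f g f0 g0 h : c != 0 ->
  (forall a, map_poly (horner_eval a) f0 = 0 ->
             map_poly (horner_eval a) g0 <> 0) ->
  c%:P * f = f0 * h -> c%:P * g = g0 * h ->
  exists2 h', f = f0 * h' & g = g0 * h'.
Proof.
move=> + f0g0; have [n] := ubnP (size c).
elim: n => // n IH in c h *; rewrite ltnS => cn c0 Ef Eg.
have [/eqP/size_poly1P[k k0 cE]|/closed_rootP[a /factor_theorem[c' cE]]] :=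
    eqVneq (size c) 1%N.
  exists (k^-1%:P%:P * h); rewrite mulrCA.
    by rewrite -Ef cE mulrA -!polyCM mulVf// mul1r.
  by rewrite -Eg cE mulrA -!polyCM mulVf// mul1r.
have Xa0 : ('X - a%:P)%:P != 0 :> {poly {poly K}}.
  by rewrite polyC_eq0 polyXsubC_eq0.
have c'0 : c' != 0 by apply: contraNneq c0 => c'0; rewrite cE c'0 mul0r.
rewrite mulrC in cE; move: Ef Eg; rewrite cE polyCM -!mulrA => Ef Eg.
have [h1 hE] : exists h1, h = ('X - a%:P)%:P * h1.
  apply: dvd_polyC_XsubC.
  have /eqP := eval_polyC_XsubC a (c'%:P * f).
  have /eqP := eval_polyC_XsubC a (c'%:P * g).
  rewrite Ef Eg !rmorphM !mulf_eq0 /= => /orP[/eqP g0a|/eqP//].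
  by move=> /orP[/eqP/f0g0|/eqP].
apply: (IH c' h1) => //.
- by move: cn; rewrite cE size_monicM ?monicXsubC// size_XsubC.
- by apply: (mulfI Xa0); rewrite Ef hE; ring.
- by apply: (mulfI Xa0); rewrite Eg hE; ring.
Qed.

(** Here c is the content of d in K[z2]. Splitting off a factor z2 - a lowers the z2-degree of the
    leading coefficient, so the process stops. *)
Lemma primitive_part d : d != 0 ->
  exists c d', [/\ c != 0, d = c%:P * d', size d' = size d &
                   forall a, map_poly (horner_eval a) d' <> 0].
Proof.
have [n] := ubnP (size (lead_coef d)); elim: n => // n IH in d *.
rewrite ltnS => dn d0.
have [[a /dvd_polyC_XsubC[d1 dE]]|nd] :=
    pselect (exists a, map_poly (horner_eval a) d = 0); last first.
  exists 1, d; split => //; rewrite ?oner_neq0 ?mul1r// => a da.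
  by apply: nd; exists a.
have d10 : d1 != 0 by apply: contraNneq d0 => d10; rewrite dE d10 mulr0.
have [|c [d' [c0 d1E sd' d'a]]] := IH d1 _ d10.
  apply: leq_trans dn; rewrite dE lead_coefM lead_coefC.
  by rewrite size_monicM ?monicXsubC ?lead_coef_eq0// size_XsubC.
exists (('X - a%:P) * c), d'; split => //.
- by rewrite mulf_neq0// polyXsubC_eq0.
- by rewrite dE d1E polyCM mulrA.
- by rewrite sd' dE size_Cmul// polyXsubC_eq0.
Qed.

Lemma no_common_factor_eval f g : no_common_factor f g ->
  forall a, map_poly (horner_eval a) f = 0 -> map_poly (horner_eval a) g <> 0.
Proof.
move=> fg a /dvd_polyC_XsubC[f' fE] /dvd_polyC_XsubC[g' gE].
have := fg _ _ _ fE gE.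
by rewrite poly_unitE coefC /= poly_unitE size_XsubC andbF.
Qed.

(** [gcdp] is a gcd only up to factors from K[z2]. By Gauss's lemma its primitive part divides f and
    g in K[z1, z2] itself, so a positive z1-degree would yield a common factor. *)
Lemma no_common_factor_gcdp f g : f != 0 -> no_common_factor f g ->
  (size (gcdp f g) <= 1)%N.
Proof.
move=> f0 fg; rewrite leqNgt; apply/negP => d1.
have d0 : gcdp f g != 0 by rewrite gcdp_eq0 (negPf f0).
have [c [d' [c0 dE sd' d'a]]] := primitive_part d0.
have dvd h : gcdp f g %| h -> exists h', h = d' * h'.
  move=> /Pdiv.Idomain.dvdpP[[k q] /= k0 E].
  (* Pseudo-division gives k h = d' (c q). As d' is primitive, k cancels: this is [cancel_polyC]
     with two equal pairs. *)
  have [|||h' hE _] := @cancel_polyC k h h d' d' (c%:P * q) k0.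
  - by move=> a /d'a.
  - by rewrite mul_polyC E dE; ring.
  - by rewrite mul_polyC E dE; ring.
  - by exists h'.
have [f' fE] := dvd _ (dvdp_gcdl f g).
have [g' gE] := dvd _ (dvdp_gcdr f g).
have := fg _ _ _ fE gE; rewrite poly_unitE sd' => /andP[/eqP d1' _].
by rewrite d1' in d1.
Qed.

(** Bezout over K(z2), cleared of denominators, gives c = u g0 + v f0 with c <> 0 in K[z2].
    Multiplying by f and by g and using f g0 = f0 g yields c f = f0 h and c g = g0 h for h = u g + v
    f; then c is cancelled. *)
Lemma lowest_terms_dvd f g f0 g0 : g0 != 0 -> no_common_factor f0 g0 ->
  f * g0 = f0 * g -> exists2 h, f = f0 * h & g = g0 * h.
Proof.
move=> g00 fg0 E.
have gf0 : no_common_factor g0 f0 by move=> d x y gE fE; exact: fg0 fE gE.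
have d0 : gcdp g0 f0 != 0 by rewrite gcdp_eq0 (negPf g00).
have /size1_polyC dE := no_common_factor_gcdp g00 gf0.
have [[u v]] := Bezoutp g0 f0.
rewrite dE => /Pdiv.Idomain.eqpP[[c1 c2] /= /andP[c10 c20] B].
have Cn0 : c2 * (gcdp g0 f0)`_0 != 0.
  by rewrite mulf_neq0// -polyC_eq0 -dE.
have {}B : (c2 * (gcdp g0 f0)`_0)%:P = c1 *: (u * g0 + v * f0).
  by rewrite B polyCM mul_polyC.
apply: (cancel_polyC (h := c1 *: (u * g + v * f)) Cn0).
- exact: no_common_factor_eval.
- rewrite B -scalerAl -scalerAr; congr (_ *: _).
  transitivity (u * (f * g0) + v * f0 * f); first by ring.
  by rewrite E; ring.
- rewrite B -scalerAl -scalerAr; congr (_ *: _).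
  transitivity (u * g0 * g + v * (f0 * g)); first by ring.
  by rewrite -E; ring.
Qed.

(** Cancelling a nonunit common factor lowers [size g + sizeY g], because a nonzero polynomial of
    degree 0 in both variables is a unit. *)
Lemma exists_no_common_factor f g : g != 0 ->
  exists d f0 g0, [/\ f = d * f0, g = d * g0 & no_common_factor f0 g0].
Proof.
have [n] := ubnP (size g + sizeY g); elim: n => // n IH in f g *.
rewrite ltnS => gn g0.
have [fg|] := pselect (no_common_factor f g).
  by exists 1, f, g; rewrite !mul1r.
move=> nfg.
have [d [f1 [g1 [fE gE /negP du]]]] : exists d f1 g1,
    [/\ f = d * f1, g = d * g1 & ~ (d \is a GRing.unit)].
  apply: contrapT => H; apply: nfg => d f1 g1 fE gE.
  by apply: contrapT => du; apply: H; exists d, f1, g1.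
move: (g0); rewrite gE mulf_eq0 negb_or => /andP[d0 g10].
have [|d' [f0 [g0' [f1E g1E fg0]]]] := IH f1 g1 _ g10.
  apply: leq_trans gn; rewrite gE !sizeYE rmorphM /=.
  rewrite !size_mul ?swapXY_eq0//.
  have d1 : (0 < size d)%N by rewrite size_poly_gt0.
  have d2 : (0 < size (swapXY d))%N by rewrite size_poly_gt0 swapXY_eq0.
  have g11 : (0 < size g1)%N by rewrite size_poly_gt0.
  have g12 : (0 < size (swapXY g1))%N by rewrite size_poly_gt0 swapXY_eq0.
  have lt_add (a b i j : nat) : (0 < a -> 0 < b -> 0 < i -> 0 < j ->
      2 < a + b -> i + j < (a + i).-1 + (b + j).-1)%N by lia.
  apply: lt_add => //; rewrite ltnNge; apply: contra du => sd.
  have eq1 (a b : nat) :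
    (0 < a -> 0 < b -> a + b <= 2 -> a = 1 /\ b = 1)%N by lia.
  have [/eqP/size_poly1P[q q0 dE]] := eq1 _ _ d1 d2 sd.
  rewrite dE swapXY_polyC size_map_polyC => /eqP/size_poly1P[k k0 qE].
  by rewrite qE poly_unitE coefC /= poly_unitE coefC /= !size_polyC
    polyC_eq0 k0 unitfE k0.
by exists (d * d'), f0, g0'; split; rewrite // -mulrA -?f1E -?g1E.
Qed.

End LowestTerms.

(** * The Euler operator and slices through the origin *)

Section Euler.
Variable K : comNzRingType.
Implicit Types p q : {poly {poly K}}.

(* The Euler operator z1 d/dz1 + z2 d/dz2. *)
Definition euler p : {poly {poly K}} :=
  \poly_(i < size p) \poly_(j < sizeY p) (p`_i`_j *+ (i + j)).

(** The restriction of p to the line t -> (t x, t y). *)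
Definition slice (x y : K) p : {poly K} :=
  (map_poly (comp_poly (y *: 'X)) p).[x *: 'X].

Lemma coef_euler p i j : (euler p)`_i`_j = p`_i`_j *+ (i + j).
Proof.
rewrite coef_poly; case: ltnP => [_|pi]; last first.
  by rewrite [p`_i]nth_default// !coef0 mul0rn.
rewrite coef_poly; case: ltnP => // pj.
by rewrite [p`_i`_j]nth_default ?mul0rn// (leq_trans (max_size_coefXY _ _)).
Qed.

Lemma size_euler p : (size (euler p) <= size p)%N.
Proof. exact: size_poly. Qed.

Lemma sizeY_euler p : (sizeY (euler p) <= sizeY p)%N.
Proof.
apply/bigmax_leqP => i _; rewrite coef_poly.
by case: ifP => _; [exact: size_poly|rewrite size_poly0].
Qed.

Lemma sliceM x y p q : slice x y (p * q) = slice x y p * slice x y q.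
Proof. by rewrite /slice rmorphM hornerM. Qed.

Lemma horner_slice x y p t : (slice x y p).[t] = p.[t * x, t * y].
Proof.
rewrite /slice; elim/poly_ind: p => [|p c IH].
  by rewrite rmorph0 !horner0.
rewrite rmorphD rmorphM /= map_polyX map_polyC /= !hornerE /= IH horner_comp.
  by rewrite hornerZ hornerX (mulrC y) mulrAC.
Qed.

Lemma slice_sum x y p (a b : nat) : (size p <= a)%N -> (sizeY p <= b)%N ->
  slice x y p =
  \sum_(i < a) \sum_(j < b) (p`_i`_j * x ^+ i * y ^+ j) *: 'X^(i + j).
Proof.
move=> pa pb; rewrite /slice.
rewrite (horner_coef_wide _ (leq_trans (size_poly _ _) pa)).
apply: eq_bigr => i _; rewrite coef_map /= /comp_poly.
have pib : (size (p`_i)%R <= b)%N by exact: leq_trans (max_size_coefXY _ _) pb.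
rewrite (horner_coef_wide _ (leq_trans (size_poly _ _) pib)) mulr_suml.
apply: eq_bigr => j _; rewrite coef_map /= !exprZn mul_polyC.
by rewrite -!(scalerAl, scalerAr) !scalerA -exprD addnC; congr (_ *: _); ring.
Qed.

(** Along a line through 0 the Euler operator is t d/dt: both sides multiply a term in t^(i+j) by i
    + j. *)
Lemma slice_euler x y p : slice x y (euler p) = 'X * (slice x y p)^`().
Proof.
rewrite (slice_sum x y (size_euler p) (sizeY_euler p)).
rewrite (slice_sum x y (leqnn (size p)) (leqnn (sizeY p))).
rewrite raddf_sum mulr_sumr; apply: eq_bigr => i _.
rewrite raddf_sum mulr_sumr; apply: eq_bigr => j _.
rewrite coef_euler /= derivZ derivXn -scalerAr !mulrnAl -scalerMnl mulrnAr.
rewrite scalerMnr; congr (_ *: _).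
by case: (i + j)%N => [|k]; rewrite ?mulr0n// -exprS.
Qed.

Lemma size_slice x y p :
  (size (slice x y p) <= ((size p).-1 + (sizeY p).-1).+1)%N.
Proof.
rewrite (slice_sum x y (leqSpred (size p)) (leqSpred (sizeY p))).
apply: (leq_trans (size_sum _ _ _)); apply/bigmax_leqP => i _.
apply: (leq_trans (size_sum _ _ _)); apply/bigmax_leqP => j _.
apply: (leq_trans (size_scale_leq _ _)); rewrite size_polyXn ltnS.
by rewrite leq_add// -ltnS.
Qed.

End Euler.

Local Open Scope complex_scope.

(** * Numerator and denominator on the torus and on the bidisk *)

Section Symmetric.
Variable R : realType.
Local Notation C := R[i].
Implicit Types p r : {poly {poly C}}.

Definition total_degree_bound p : nat := (bidegree p).1 + (bidegree p).2.

(** The monomial z1^i z2^j gets the weight (m - i) + (n - j), which [euler] gives to its mirror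
    image z1^(m-i) z2^(n-j). *)
Definition coeuler p := p *+ total_degree_bound p - euler p.

Lemma reflection_coef r (lam : C) (i j : nat) :
  reflection r = lam%:P%:P * r ->
  (i <= (bidegree r).1)%N -> (j <= (bidegree r).2)%N ->
  conjc r`_((bidegree r).1 - i)`_((bidegree r).2 - j) = lam * r`_i`_j.
Proof.
move=> rS im jn; have := congr1 (fun p => p`_i`_j) rS.
by rewrite coef_poly ltnS im coef_poly ltnS jn !coefCM.
Qed.

Lemma horner_euler r (x y : C) :
  (euler r).[x, y] = \sum_(i < (bidegree r).1.+1) \sum_(j < (bidegree r).2.+1)
     (i + j)%:R * (r`_i`_j * x ^+ i * y ^+ j).
Proof.
rewrite (horner2_sum _ _ (leq_trans (size_euler r) (leqSpred _))
                         (leq_trans (sizeY_euler r) (leqSpred _))).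
apply: eq_bigr => i _; apply: eq_bigr => j _.
by rewrite coef_euler mulr_natl -!mulrnAl.
Qed.

Lemma horner_coeuler r (x y : C) :
  (coeuler r).[x, y] = \sum_(i < (bidegree r).1.+1) \sum_(j < (bidegree r).2.+1)
     ((bidegree r).1 - i + ((bidegree r).2 - j))%:R
       * (r`_i`_j * x ^+ i * y ^+ j).
Proof.
rewrite /coeuler !hornerE hornerMn horner_euler !hornerMn.
rewrite (@horner2_sum _ _ (bidegree r).1.+1 (bidegree r).2.+1) ?leqSpred//.
rewrite -mulr_natl mulr_sumr -sumrB; apply: eq_bigr => i _.
rewrite mulr_sumr -sumrB; apply: eq_bigr => j _.
rewrite -mulrBl -natrB; last by rewrite leq_add// -ltnS.
congr (_%:R * _).
by have := ltn_ord i; have := ltn_ord j; rewrite /total_degree_bound; lia.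
Qed.

(** Reversing both indices exchanges the two weights and, by symmetry, conjugates the coefficients
    of r up to lam. As conj x = 1/x on the circle, lam times [coeuler r] equals x^m y^n times the
    conjugate of [euler r] there. *)
Lemma coeuler_torus r (lam x y : C) : reflection r = lam%:P%:P * r ->
  `|lam| = 1 -> `|x| = 1 -> `|y| = 1 ->
  `|(euler r).[x, y]| = `|(coeuler r).[x, y]|.
Proof.
move=> rS l1 x1 y1.
have nz (z : C) : `|z| = 1 -> z != 0.
  by move=> z1; rewrite -normr_eq0 z1 oner_neq0.
have cV (z : C) : `|z| = 1 -> conjc z = z^-1.
  by move=> z1; rewrite invc_norm z1 expr1n invr1 mul1r.
set m := (bidegree r).1; set n := (bidegree r).2.
suff E : lam * (coeuler r).[x, y] =
    x ^+ m * y ^+ n * conjc (euler r).[x, y].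
  rewrite -[RHS]mul1r -[in RHS]l1 -normrM E !normrM !normrX x1 y1 !expr1n.
  by rewrite !mul1r normcJ.
rewrite horner_coeuler horner_euler mulr_sumr.
rewrite (reindex_inj rev_ord_inj) /= rmorph_sum mulr_sumr.
apply: eq_bigr => i _; rewrite mulr_sumr.
rewrite (reindex_inj rev_ord_inj) /= rmorph_sum mulr_sumr.
apply: eq_bigr => j _.
have im : (i <= m)%N by rewrite -ltnS.
have jn : (j <= n)%N by rewrite -ltnS.
rewrite !subSS -/m -/n !subKn// !rmorphM !rmorphXn rmorph_nat /=.
rewrite (cV x)// (cV y)// !exprVn.
rewrite !exprB ?unitfE ?nz//.
have := reflection_coef rS (leq_subr i m) (leq_subr j n).
rewrite -/m -/n !subKn// => ->.
by rewrite [LHS](AC (1*(1*(1*2*2))) ((4*6)*(2*(1*3*5*7)))).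
Qed.

Lemma bidisk_scale (x y t : C) :
  bidisk (x, y) -> `|t| <= 1 -> bidisk (t * x, t * y).
Proof.
move=> [/= x1 y1] t1; split => /=; rewrite normrM.
  by rewrite (le_lt_trans _ x1)// ler_piMl.
by rewrite (le_lt_trans _ y1)// ler_piMl.
Qed.

(** [deriv_at1_bound] applies to the slice through z: its derivative at t = 1 is the Euler term, and
    a zero t with |t| <= 1 would give a zero of r in the bidisk. *)
Lemma euler_coeuler_bidisk r (z : C * C) : (0 < total_degree_bound r)%N ->
  (forall z, bidisk z -> r.[z.1, z.2] != 0) -> bidisk z ->
  (coeuler r).[z.1, z.2] != 0 /\
  `|(euler r).[z.1, z.2]| <= `|(coeuler r).[z.1, z.2]|.
Proof.
case: z => x y /= N0 r0 xyD.
have Ee : (euler r).[x, y] = (slice x y r)^`().[1].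
  have /(congr1 (horner^~ 1)) := slice_euler x y r.
  by rewrite horner_slice hornerM hornerX !mul1r.
have re : r.[x, y] = (slice x y r).[1] by rewrite horner_slice !mul1r.
rewrite /coeuler hornerD hornerN hornerMn hornerD hornerN hornerMn Ee re.
rewrite -mulr_natl; apply: deriv_at1_bound => //; first exact: size_slice.
move=> a; rewrite /root horner_slice; apply: contraTT.
rewrite -real_leNgt ?normr_real//.
by move=> a1; exact: (r0 (_, _) (bidisk_scale xyD a1)).
Qed.

(* The line through 0 and (x, y) is not contained in the zero set of d, since
   [r.[0, 0] != 0]. *)
Lemma euler_factor_zero d s e r (x y : C) : r.[0, 0] != 0 ->
  r = d * s -> euler r = d * e -> r.[x, y] = 0 -> s.[x, y] = 0.
Proof.
move=> r00 rE erE.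
have d00 : d.[0, 0] != 0.
  by apply: contraNneq r00 => d00; rewrite rE !hornerM d00 mul0r.
rewrite rE !hornerM => /eqP; rewrite mulf_eq0 => /orP[/eqP dxy|/eqP//].
have H : 'X * (slice x y d * slice x y s)^`() = slice x y d * slice x y e.
  by rewrite -!sliceM -rE -erE slice_euler.
have : root (slice x y s) 1.
  apply: root_cofactor_of_dvd_deriv H; rewrite ?oner_neq0//.
    apply: contraNneq d00 => d0.
    by have := horner_slice x y d 0; rewrite d0 horner0 !mul0r => <-.
  by rewrite /root horner_slice !mul1r dxy.
by rewrite /root horner_slice !mul1r => /eqP.
Qed.

Lemma differentiable_horner2 p (z : C^o * C^o) :
  differentiable (fun z : C^o * C^o => p.[z.1, z.2] : C^o) z.
Proof.
have dfst : differentiable (fst : C^o * C^o -> C^o) z.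
  by apply: linear_differentiable => w; exact: cvg_fst.
have dsnd : differentiable (snd : C^o * C^o -> C^o) z.
  by apply: linear_differentiable => w; exact: cvg_snd.
have d1 (q : {poly C}) : differentiable (fun z : C^o * C^o => q.[z.2] : C^o) z.
  elim/poly_ind: q => [|q c IH].
    under eq_fun do rewrite horner0.
    exact: differentiable_cst.
  under eq_fun do rewrite hornerMXaddC.
  apply: differentiableD; last exact: differentiable_cst.
  exact: differentiableM.
elim/poly_ind: p => [|p c IH].
  under eq_fun do rewrite !horner0.
  exact: differentiable_cst.
under eq_fun do rewrite hornerMXaddC !hornerE.
apply: differentiableD; last exact: d1.
exact: differentiableM.
Qed.

End Symmetric.

(** * Zeros on the torus *)

Section Torus.
Variable R : realType.
Local Notation C := R[i].
Local Notation mu := (@lebesgue_measure R).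
Implicit Types p g : {poly {poly C}}.

Lemma normr_unit_point (t : R) : `|unit_point t| = 1.
Proof. by rewrite normc_def /= cos2Dsin2 sqrtr1. Qed.

Lemma countable_angles (q : {poly C}) : q != 0 ->
  countable [set t : R | 0 <= t < 2 * pi /\ q.[unit_point t] = 0].
Proof.
move=> q0; have [s qE] := closed_field_poly_normal q.
(* The cosine determines an angle in [0, 2 pi[ up to t -> 2 pi - t, so this finite list contains
   every candidate. *)
pose B := [seq acos (complex.Re z) | z <- s] ++
          [seq 2 * pi - acos (complex.Re z) | z <- s].
apply: (@sub_countable _ _ _ [set` B]); last first.
  exact/finite_set_countable/finite_seq.
apply: subset_card_le => t [/andP[t0 t2] qt] /=.
have : root (\prod_(z <- s) ('X - z%:P)) (unit_point t).
  by rewrite -(rootZ _ _ (_ : lead_coef q != 0)) ?lead_coef_eq0// -qE /root qt.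
rewrite root_prod_XsubC => ts; rewrite mem_cat; apply/orP.
have [tpi|tpi] := leP t pi.
  left; apply/mapP; exists (unit_point t) => //=.
  by rewrite cosK// in_itv /= t0.
right; apply/mapP; exists (unit_point t) => //=.
have -> : cos t = cos (2 * pi - t).
  by rewrite mulr_natl addrC cosD2pi cosN.
rewrite cosK; first by ring.
by rewrite in_itv /=; apply/andP; split; lra.
Qed.

(* R[i] carries no sigma-algebra here, so measurability is stated for the two
   real components. *)
Definition cmeasurable (f : R * R -> C) :=
  measurable_fun [set: R * R] (fun t => complex.Re (f t)) /\
  measurable_fun [set: R * R] (fun t => complex.Im (f t)).

Lemma cmeasurable_cst c : cmeasurable (fun=> c).
Proof. by split; exact: measurable_cst. Qed.

Lemma cmeasurableD (f g : R * R -> C) : cmeasurable f -> cmeasurable g ->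
  cmeasurable (fun t => f t + g t).
Proof.
move=> [f1 f2] [g1 g2]; split; under eq_fun do rewrite raddfD/=;
  exact: measurable_funD.
Qed.

Lemma cmeasurableM (f g : R * R -> C) : cmeasurable f -> cmeasurable g ->
  cmeasurable (fun t => f t * g t).
Proof.
move=> [f1 f2] [g1 g2]; split.
  have -> : (fun t => complex.Re (f t * g t)) = fun t =>
     complex.Re (f t) * complex.Re (g t) - complex.Im (f t) * complex.Im (g t).
    by apply/funext => t; case: (f t) (g t) => [? ?] [? ?].
  by apply: measurable_funB; exact: measurable_funM.
have -> : (fun t => complex.Im (f t * g t)) = fun t =>
   complex.Re (f t) * complex.Im (g t) + complex.Im (f t) * complex.Re (g t).
  by apply/funext => t; case: (f t) (g t) => [? ?] [? ?].
by apply: measurable_funD; exact: measurable_funM.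
Qed.

Lemma cmeasurable_horner2 p :
  cmeasurable (fun t => p.[unit_point t.1, unit_point t.2]).
Proof.
have mcos : measurable_fun [set: R] (@cos R).
  by apply: continuous_measurable_fun => x; exact: continuous_cos.
have msin : measurable_fun [set: R] (@sin R).
  by apply: continuous_measurable_fun => x; exact: continuous_sin.
have m1 : cmeasurable (fun t => unit_point t.1).
  by split; exact: (measurableT_comp _ measurable_fst).
have m2 : cmeasurable (fun t => unit_point t.2).
  by split; exact: (measurableT_comp _ measurable_snd).
have mq (q : {poly C}) : cmeasurable (fun t => q.[unit_point t.2]).
  elim/poly_ind: q => [|q c IH].
    by under eq_fun do rewrite horner0; exact: cmeasurable_cst.
  under eq_fun do rewrite hornerMXaddC.
  by apply: cmeasurableD (cmeasurable_cst _); exact: cmeasurableM.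
elim/poly_ind: p => [|p c IH].
  by under eq_fun do rewrite !horner0; exact: cmeasurable_cst.
under eq_fun do rewrite hornerMXaddC hornerD hornerM hornerC.
by apply: cmeasurableD (mq _); exact: cmeasurableM.
Qed.

(** By Fubini: fixing the first angle outside a countable set leaves a nonzero polynomial in z2,
    which has countably many zero angles. *)
Lemma negligible_torus_zeros g : g != 0 ->
  (mu \x mu)%E.-negligible [set t : R * R |
    [/\ 0 <= t.1 < 2 * pi, 0 <= t.2 < 2 * pi &
        g.[unit_point t.1, unit_point t.2] = 0]].
Proof.
move=> g0; set A := [set _ | _].
pose I := [set t : R | 0 <= t < 2 * pi].
have mI : measurable I.
  rewrite (_ : I = `[0, 2 * pi[%classic); first exact: measurable_itv.
  by apply/seteqP; split => t /=; rewrite in_itv.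
have [m1 m2] := cmeasurable_horner2 g.
have mA : measurable A.
  pose G (t : R * R) := g.[unit_point t.1, unit_point t.2].
  rewrite (_ : A = (I `*` I) `&`
    ((setT `&` (fun t => complex.Re (G t)) @^-1` [set 0])
     `&` (setT `&` (fun t => complex.Im (G t)) @^-1` [set 0]))).
    apply: measurableI; first exact: measurableX.
    apply: measurableI; [apply: m1|apply: m2] => //; exact: measurable_set1.
  apply/seteqP; split => t /=.
    by rewrite /G => -[t1 t2 ->].
  rewrite /G => -[[t1 t2] [[_ a] [_ b]]]; split=> //.
  by apply/eqP; rewrite eq_complex a b !eqxx.
apply/negligibleP => //.
(* This is the leading coefficient of g in z2, a polynomial in z1. Where it does not vanish, fixing
   z1 leaves a nonzero polynomial. *)
have gj : lead_coef (swapXY g) != 0 by rewrite lead_coef_eq0 swapXY_eq0.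
have B0 := countable_lebesgue_measure0 (countable_angles gj).
set B := [set t | _] in B0.
have mB : measurable B by exact/countable_measurable/(countable_angles gj).
(* The product measure of A is the integral of the measures of its sections, which are null off
   B. *)
transitivity (\int[mu]_x cst 0%E x)%E; last by rewrite integral0.
apply: (@ae_eq_integral _ _ _ mu setT) => //.
  exact: (@measurable_fun_xsection _ _ _ _ _ mu).
exists B; split => // x; apply: contra_notP => Bx _ /=.
have [xI|xI] := pselect (I x); last first.
  rewrite (_ : xsection A x = set0) ?measure0//.
  by apply/seteqP; split => y //=; rewrite /xsection /= inE => -[].
apply: countable_lebesgue_measure0.
have qx : g.[(unit_point x)%:P] != 0.
  apply/eqP => gx; apply: Bx; split=> //.
  have := congr1 (fun u : {poly C} => u`_(size (swapXY g)).-1) gx.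
  by rewrite horner_polyC coef_map coef0.
apply: sub_countable (countable_angles qx).
by apply: subset_card_le => y; rewrite /xsection /= inE => -[].
Qed.

End Torus.

(** * The inner function and its level set *)

Section Main.
Variable R : realType.
Local Notation C := R[i].

Lemma total_degree_bound_gt0 (r : {poly {poly C}}) :
  (forall c : C, r <> c%:P%:P) -> (0 < total_degree_bound r)%N.
Proof.
move=> rc; rewrite lt0n addn_eq0; apply/negP => /andP[/= /eqP m0 /eqP n0].
have /size1_polyC rE : (size r <= 1)%N by rewrite (leq_trans (leqSpred _))// m0.
have : (size (r`_0)%R <= 1)%N.
  by rewrite (leq_trans (max_size_coefXY _ _))// (leq_trans (leqSpred _))// n0.
by move=> /size1_polyC r0E; apply: (rc r`_0`_0); rewrite -r0E -rE.
Qed.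

Lemma tofrac_ratio (f g d f0 g0 : {poly {poly C}}) : g != 0 ->
  f = d * f0 -> g = d * g0 -> tofrac f / tofrac g = tofrac f0 / tofrac g0.
Proof.
move=> gn0 -> gE; move: gn0; rewrite gE mulf_eq0 negb_or => /andP[d0 g00].
by rewrite !tofracM -mulf_div divff ?mul1r// tofrac_eq0.
Qed.

Lemma rational_inner_euler (r : {poly {poly C}}) (lam : C) :
  `|lam| = 1 -> reflection r = lam%:P%:P * r ->
  (0 < total_degree_bound r)%N ->
  (forall z : C * C, bidisk z -> r.[z.1, z.2] != 0) ->
  rational_inner (tofrac (- lam%:P%:P * euler r) / tofrac (coeuler r)).
Proof.
move=> l1 rS N0 r0; set f := - _ * _.
have fE (x y : C) : `|f.[x, y]| = `|(euler r).[x, y]|.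
  by rewrite /f mulNr !hornerN !hornerM !hornerC normrN normrM l1 mul1r.
have D0 : bidisk (0 : C, 0 : C) by split; rewrite /= normr0 ltr01.
have g0 : coeuler r != 0.
  have [+ _] := euler_coeuler_bidisk N0 r0 D0.
  by apply: contraNneq => ->; rewrite !horner0.
split.
  exists (fun z => f.[z.1, z.2] / (coeuler r).[z.1, z.2]); split.
  - move=> z zD; exists f, (coeuler r); split=> //.
    by have [] := euler_coeuler_bidisk N0 r0 zD.
  - move=> z zD; apply: differentiableM; first exact: differentiable_horner2.
    apply: differentiableV; first exact: differentiable_horner2.
    by have [] := euler_coeuler_bidisk N0 r0 zD.
  - exists 1 => z zD; have [gz le] := euler_coeuler_bidisk N0 r0 zD.
    by rewrite normrM normfV ler_pdivrMr ?normr_gt0// mul1r fE.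
(* Exceptional angles lie over zeros of the denominator; elsewhere numerator and denominator have
   the same nonzero modulus. *)
apply: negligibleS (negligible_torus_zeros g0) => t /= H.
apply: contrapT => nH; apply: H => t1 t2.
have gt0 : (coeuler r).[unit_point t.1, unit_point t.2] != 0.
  by apply/eqP => gt0; apply: nH.
eexists; first by exists f, (coeuler r); split.
rewrite normrM normfV fE (coeuler_torus rS l1) ?normr_unit_point//.
by rewrite divff// normr_eq0.
Qed.

Lemma level_set_euler (r : {poly {poly C}}) (lam : C) :
  lam != 0 -> (0 < total_degree_bound r)%N -> r.[0, 0] != 0 ->
  coeuler r != 0 ->
  level_set lam (tofrac (- lam%:P%:P * euler r) / tofrac (coeuler r))
  = zero_set r.
Proof.
move=> l0 N0 r00 g0; set f := - _ * _; set g := coeuler r in g0 *.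
set N := total_degree_bound r in N0.
have fgE : f - lam%:P%:P * g = - lam%:P%:P * (r *+ N).
  by rewrite /f /g /coeuler -/N; ring.
have Nl0 : - lam *+ N != 0 by rewrite mulrn_eq0 oppr_eq0 negb_or -lt0n N0.
have rz (z : C * C) :
    (r.[z.1, z.2] == 0) = (f.[z.1, z.2] - lam * g.[z.1, z.2] == 0).
  have -> : f.[z.1, z.2] - lam * g.[z.1, z.2] = (f - lam%:P%:P * g).[z.1, z.2].
    by rewrite !(hornerD, hornerN, hornerM, hornerC).
  rewrite fgE mulNr !hornerN !hornerM !hornerMn !hornerC oppr_eq0 mulf_eq0.
  by rewrite (negPf l0) mulrn_eq0 eqn0Ngt N0.
apply/seteqP; split => z /=.
  (* Any pair in lowest terms divides (f, g) with a common cofactor h, so a zero of f0 - lam g1 is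
     one of f - lam g, hence of r. *)
  move=> [f0 [g1 [[g10 E fg] fgz]]].
  have {}E : f * g1 = f0 * g.
    apply/eqP; rewrite -tofrac_eq (tofracM f) (tofracM f0).
    by rewrite -eqr_div ?tofrac_eq0//; exact/eqP.
  have [h fE gE] := lowest_terms_dvd g10 fg E.
  by apply/eqP; rewrite rz fE gE !hornerM fgz; apply/eqP; ring.
move=> /eqP rz0; have [d [f0 [g1 [fE gE fg]]]] := exists_no_common_factor f g0.
exists f0, g1; split.
  split; [|exact: (tofrac_ratio g0 fE gE)|exact: fg].
  by apply: contraNneq g0 => g10; rewrite gE g10 mulr0.
apply/eqP; rewrite -subr_eq0.
(* Since d (f0 - lam g1) = - lam N r, this scalar makes k (f0 - lam g1) the cofactor of d in r. As d
   also divides [euler r], [euler_factor_zero] makes the cofactor vanish wherever r does. *)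
pose k := (- lam *+ N)^-1.
have rE : r = d * (k%:P%:P * (f0 - lam%:P%:P * g1)).
  have : d * (f0 - lam%:P%:P * g1) = (- lam *+ N)%:P%:P * r.
    by rewrite mulrBr mulrCA -fE -gE fgE !polyCMn !polyCN; ring.
  by rewrite mulrCA => ->; rewrite mulrA -!polyCM mulVf// mul1r.
have eE : euler r = d * ((- lam)^-1%:P%:P * f0).
  by rewrite mulrCA -fE /f mulrA -!polyCN -!polyCM mulVf ?oppr_eq0// mul1r.
have := euler_factor_zero r00 rE eE (eqP rz0).
rewrite !hornerM !hornerC => /eqP; rewrite mulf_eq0 invr_eq0 (negPf Nl0) /=.
by rewrite !(hornerD, hornerN, hornerM, hornerC).
Qed.
End Main.

Theorem theorem6p1 (R : realType) (r : {poly {poly R[i]}}) (lam : R[i])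
  (r_nonconstant : forall c : R[i], r <> c%:P%:P)
  (lam_unimodular : `|lam| = 1)
  (r_symmetric : reflection r = lam%:P%:P * r)
  (r_zero_free : forall z : R[i] * R[i], bidisk z -> r.[z.1, z.2] != 0) :
  exists phi : {fraction {poly {poly R[i]}}},
    rational_inner phi /\ level_set lam phi = zero_set r.
Proof.
have N0 := total_degree_bound_gt0 r_nonconstant.
have D0 : bidisk (0 : R[i], 0 : R[i]) by split; rewrite /= normr0 ltr01.
have [g00 _] := euler_coeuler_bidisk N0 r_zero_free D0.
exists (tofrac (- lam%:P%:P * euler r) / tofrac (coeuler r)); split.
  exact: rational_inner_euler.
apply: level_set_euler => //.
- by rewrite -normr_eq0 lam_unimodular oner_neq0.
- exact: (r_zero_free _ D0).
- by apply: contraNneq g00 => ->; rewrite !horner0.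
Qed.
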